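(* Let $m,n\geq1$ be integers with $d=m+n\geq3$, let $\Theta$ be a real $n\times m$ matrix, and let $\overline\Psi_p$ be as in the context. Then \[ \overline\Psi_2\leq\frac{(d-2)\overline\Psi_1}{(n-1)+n\overline\Psi_1}\quad\text{if }\ \overline\Psi_1\geq\frac{m-n}{2n},\qquad \overline\Psi_2\leq\frac{(d-2)\overline\Psi_1}{(m-1)-n\overline\Psi_1}\quad\text{if }\ \overline\Psi_1\leq\frac{m-n}{2n}. \]
   Context: Let $T=\begin{pmatrix}E_m&0\\ \Theta&E_n\end{pmatrix}$ ($E_k$ the $k\times k$ identity matrix) and $\Lambda=T^{-1}\mathbb Z^d$. For $s>0$ let $\boldsymbol\tau(s)\in\mathbb R^d$ be given by $\tau_1(s)=\cdots=\tau_m(s)=s$, $\tau_{m+1}(s)=\cdots=\tau_d(s)=-ms/n$, let $D_{\boldsymbol\tau(s)}$ be the diagonal matrix with diagonal entries $e^{\tau_1(s)},\ldots,e^{\tau_d(s)}$, and $\mathcal B(s)=D_{\boldsymbol\tau(s)}[-1,1]^d$. For a compact origin-symmetric convex body $M$, $\lambda_p(M)$ is its $p$-th successive minimum with respect to $\Lambda$. Set $\psi_p(s)=\ln(\lambda_p(\mathcal B(s)))/s$, $\Psi_p(s)=\sum_{i=1}^p\psi_i(s)$, $\overline\Psi_p=\limsup_{s\to+\infty}\Psi_p(s)$. *)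

(* Defs.v *)
From HB Require Import structures.
From mathcomp Require Import all_boot all_order all_algebra.
From mathcomp Require Import all_classical all_reals all_analysis.

Set Implicit Arguments.
Unset Strict Implicit.
Unset Printing Implicit Defensive.

Import Order.TTheory GRing.Theory Num.Theory.
Import numFieldNormedType.Exports.

Local Open Scope classical_set_scope.
Local Open Scope ring_scope.

Section SuccessiveMinima.
Variables (R : realType) (d : nat).
Implicit Types (L M : set 'cV[R]_d) (tau : 'rV[R]_d).

Definition dilate (l : R) M : set 'cV[R]_d := [set l *: x | x in M].

(* The p-th successive minimum of M with respect to L, for 1 <= p <= d.  The
   infimum is that of the reals: for a full-rank lattice L and a convex body M
   with 0 in its interior the set below is nonempty and bounded below. *)
Definition succ_min L M (p : nat) : R :=
  inf [set l : R | 0 < l /\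
    exists v : p.-tuple 'cV[R]_d,
      free v /\ forall i : 'I_p, (L `&` dilate l M) (tnth v i)].

Definition int_lattice : set 'cV[R]_d :=
  [set map_mx (fun z : int => z%:~R) z | z in [set: 'cV[int]_d]].

Definition unit_cube : set 'cV[R]_d :=
  [set x | forall i, `|x i ord0| <= 1].

Definition exp_diag_mx tau : 'M[R]_d := diag_mx (map_mx expR tau).

End SuccessiveMinima.

Arguments int_lattice {R d}.
Arguments unit_cube {R d}.

Section SchmidtSummerer.
Variables (R : realType) (m n : nat) (Theta : 'M[R]_(n, m)).

Definition T_mx : 'M[R]_(m + n) := block_mx 1%:M 0 Theta 1%:M.

Definition Lambda : set 'cV[R]_(m + n) :=
  [set invmx T_mx *m z | z in int_lattice].

Definition tau (s : R) : 'rV[R]_(m + n) :=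
  row_mx (const_mx s) (const_mx (- (m%:R * s) / n%:R)).

Definition parallelepiped (s : R) : set 'cV[R]_(m + n) :=
  [set exp_diag_mx (tau s) *m x | x in unit_cube].

(* Only the values for s > 0 matter. *)
Definition psi (p : nat) (s : R) : R :=
  ln (succ_min Lambda (parallelepiped s) p) / s.

Definition Psi (p : nat) (s : R) : R := \sum_(1 <= i < p.+1) psi i s.

(* The upper limit is taken in the extended reals.  Its value for 1 <= p <= d is
   finite, since all the psi_i with 1 <= i <= d are bounded as s tends to +oo. *)
Definition Psi_sup (p : nat) : \bar R :=
  limf_esup (fun s : R => (Psi p s)%:E) (+oo%R : set_system R).

End SchmidtSummerer.

(* Main.v *)
Require Import Defs.
From HB Require Import structures.
From mathcomp Require Import all_boot all_order all_algebra.
From mathcomp Require Import all_classical all_reals all_analysis.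
From mathcomp Require Import ring lra zify.

(* Write L_p(s) for the logarithm of the p-th successive minimum of B(s).  Each
   lattice vector v contributes to L_1 the function
   max (ln |x_v| - s, ln |y_v| + (m/n) s), where v = (x_v, y_v).  If v realizes
   L_1(s), say on its descending branch, then going back from s one meets a t where
   a second vector, independent of v, has the same norm e^l as v, with
   l <= L_1(t); hence L_1(s) = l - (s - t) and L_2(s) <= l + (m/n)(s - t).  The
   ascending branch is symmetric, with t >= s.  On the other hand Minkowski's
   theorem gives L_1 + (d - 1) L_2 <= O(1).  A suitable convex combination of these
   two upper bounds for L_1(s) + L_2(s), together with l <= (Psi_1 + o(1)) t, is at
   most (d - 2) Psi_1 / D * s + o(s), where D is the larger of n - 1 + n Psi_1 and
   m - 1 - n Psi_1. *)

Set Implicit Arguments.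
Unset Strict Implicit.
Unset Printing Implicit Defensive.

Import Order.TTheory GRing.Theory Num.Theory.
Import numFieldNormedType.Exports.

Local Open Scope classical_set_scope.
Local Open Scope ring_scope.

(** * Pigeonhole principle, Dirichlet approximation and minimization over integer vectors *)

Section Pigeonhole.
Variables (m n : nat) (N : 'I_m -> nat) (K : 'I_n -> nat).

Lemma card_grid k (L : 'I_k -> nat) :
  #|{dffun forall i, 'I_(L i)}| = (\prod_(i < k) L i)%N.
Proof.
rewrite card_dep_ffun foldrE big_map big_enum /=.
by apply: eq_bigr => i _; rewrite card_ord.
Qed.

Lemma grid_pigeonhole
    (f : {dffun forall i, 'I_(N i)} -> {dffun forall j, 'I_(K j)}) :
  (\prod_(j < n) K j < \prod_(i < m) N i)%N ->
  exists x y, x <> y /\ f x = f y.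
Proof.
move=> KN; apply: contrapT => f_inj; move: KN; rewrite ltnNge => /negP; apply.
rewrite -!card_grid; apply: (@leq_card _ _ f) => x y fxy.
by apply: contrapT => xy; apply: f_inj; exists x, y.
Qed.

End Pigeonhole.

Lemma truncn_eq_dist (R : realType) (a b : R) :
  0 <= a -> 0 <= b -> Num.truncn a = Num.truncn b -> `|a - b| < 1.
Proof.
move=> a0 b0 ab; have := truncn_itv a0; have := truncn_itv b0; rewrite ab.
move=> /andP[b1 b2] /andP[a1 a2]; rewrite -natr1 in a2, b2.
by rewrite ltr_norml; apply/andP; split; lra.
Qed.

Section Dirichlet.
Variables (R : realType) (m n : nat) (Theta : 'M[R]_(n, m)).
Variables (A : 'I_m -> R) (B : 'I_n -> R).

(** Among the integer points with coordinates in [0, A_i / 2], two have images under Theta whose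
    fractional parts share a cell of a grid of mesh 1 / K_j < B_j; their difference is the [x]
    sought. The power of 2 pays for rounding: A_i is at most 2 N_i, and K_j B_j is at most 2 because
    B_j <= 1. *)
Lemma dirichlet_box :
  (forall i, 0 < A i) -> (forall j, 0 < B j <= 1) ->
  2 ^+ (m + n) < (\prod_(i < m) A i) * (\prod_(j < n) B j) ->
  exists (x : 'cV[int]_m) (y : 'cV[int]_n), [/\ x != 0,
    forall i, `|(x i ord0)%:~R| < A i &
    forall j, `|(y j ord0)%:~R - (Theta *m map_mx intr x) j ord0| < B j].
Proof.
move=> A_gt0 B01 vol.
pose N i := (Num.truncn (A i / 2)).+1; pose K j := (Num.truncn (B j)^-1).+1.
pose vx (z : {dffun forall i, 'I_(N i)}) : 'cV[int]_m :=
  \col_i (z i : nat)%:Z.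
pose t z j : R := (Theta *m map_mx intr (vx z)) j ord0.
(* Scaled by [K j], the fractional part of [t z j] has the index of its cell as integer part. *)
pose b z j : R := (t z j - (Num.floor (t z j))%:~R) * (K j)%:R.
have fr z j : 0 <= t z j - (Num.floor (t z j))%:~R < 1.
  by have /andP[] := floor_itv (t z j); rewrite intrD => ? ?; apply/andP; split; lra.
have b_ge0 z j : 0 <= b z j by rewrite mulr_ge0//; have /andP[] := fr z j.
have b_lt z j : (Num.truncn (b z j) < K j)%N.
  rewrite truncn_lt_nat// /b gtr_pMl ?ltr0n//; by have /andP[] := fr z j.
pose f z : {dffun forall j, 'I_(K j)} := [ffun j => Ordinal (b_lt z j)].
have NK : (\prod_(j < n) K j < \prod_(i < m) N i)%N.
  rewrite -(ltr_nat R) !natr_prod.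
  have B_gt0 j : 0 < B j by have /andP[] := B01 j.
  have PB : 0 < \prod_(j < n) B j by apply: prodr_gt0 => j _.
  have hK : (\prod_(j < n) (K j)%:R) * \prod_(j < n) B j <= 2 ^+ n :> R.
    rewrite -big_split/= -[n in 2 ^+ n]card_ord -prodr_const.
    apply: ler_prod => j _; rewrite mulr_ge0 ?(ltW (B_gt0 j))//=.
    have [_ B1] := andP (B01 j).
    have iB : 0 <= (B j)^-1 by rewrite invr_ge0 ltW.
    have := truncn_itv iB => /andP[h _].
    rewrite /K -natr1 mulrDl mul1r.
    have : (Num.truncn (B j)^-1)%:R * B j <= 1.
      by rewrite -ler_pdivlMr// mul1r.
    lra.
  have hN : \prod_(i < m) A i <= 2 ^+ m * \prod_(i < m) (N i)%:R :> R.
    rewrite -[m in 2 ^+ m]card_ord -prodr_const -big_split/=.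
    apply: ler_prod => i _; rewrite (ltW (A_gt0 i))/=.
    by have := truncnS_gt (A i / 2); rewrite /N => h; lra.
  rewrite -(ltr_pM2r PB); apply: le_lt_trans hK _.
  rewrite -(ltr_pM2l (exprn_gt0 m (ltr0n R 2))) -exprD.
  apply: lt_le_trans vol _; rewrite mulrA ler_pM2r//.
have [z [z' [zz' fz]]] := grid_pigeonhole f NK.
exists (vx z - vx z'), (\col_j (Num.floor (t z j) - Num.floor (t z' j))); split.
- apply/negP => /eqP /colP e; apply: zz'; apply/ffunP => i; apply/val_inj.
  by have := e i; rewrite !mxE => /subr0_eq [].
- move=> i; rewrite !mxE.
  have : ((z i : nat)%:R <= A i / 2 :> R) /\ ((z' i : nat)%:R <= A i / 2 :> R).
    have A2 : 0 <= A i / 2 by have := A_gt0 i; lra.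
    by split; rewrite -truncn_ge_nat// -ltnS ltn_ord.
  have := A_gt0 i; have := ler0n R (z i); have := ler0n R (z' i).
  move=> z0 z0' A0 [h h']; rewrite intrB -!pmulrn ltr_norml; apply/andP; split; lra.
- move=> j; rewrite mxE map_mxB mulmxBr.
  have -> : (Theta *m map_mx intr (vx z) - Theta *m map_mx intr (vx z')) j ord0
     = t z j - t z' j by rewrite mxE [X in _ + X]mxE.
  have e : Num.truncn (b z j) = Num.truncn (b z' j).
    by have /ffunP /(_ j) := fz; rewrite !ffunE => -[].
  have := truncn_eq_dist (b_ge0 z j) (b_ge0 z' j) e.
  rewrite /b -mulrBl normrM [X in _ * X]ger0_norm// => h.
  have {}h : `|(t z j - (Num.floor (t z j))%:~R) - (t z' j - (Num.floor (t z' j))%:~R)|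
     < (K j)%:R^-1 by rewrite -[X in _ < X]mul1r ltr_pdivlMr ?ltr0n.
  rewrite intrB distrC.
  have -> : t z j - t z' j - ((Num.floor (t z j))%:~R - (Num.floor (t z' j))%:~R)
    = (t z j - (Num.floor (t z j))%:~R) - (t z' j - (Num.floor (t z' j))%:~R) :> R by ring.
  apply: lt_le_trans h _; have /andP[B0 B1] := B01 j.
  rewrite -[X in _ <= X]invrK lef_pV2 ?posrE ?invr_gt0 ?ltr0n//.
  exact: ltW (truncnS_gt _).
Qed.

End Dirichlet.

Lemma int_vec_argmin (R : realType) (d : nat) (P : set 'cV[int]_d)
    (f : 'cV[int]_d -> R) (b : R) (z0 : 'cV[int]_d) : P z0 ->
  (forall z, P z -> f z <= f z0 -> forall k, `|(z k ord0)%:~R| <= b) ->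
  exists2 z, P z & forall z', P z' -> f z <= f z'.
Proof.
move=> Pz0 bnd; pose N := Num.truncn b.
(* Shifted by [N], these finite functions run over all integer vectors with coordinates of absolute
   value at most [N], so the minimization becomes a finite search. *)
pose g (phi : {ffun 'I_d -> 'I_(N + N).+1}) : 'cV[int]_d :=
  \col_k ((phi k : nat)%:Z - N%:Z).
have g_onto z : P z -> f z <= f z0 -> exists phi, g phi = z.
  move=> Pz fz; have zN k : (absz (z k ord0) <= N)%N.
    have h := bnd z Pz fz k; rewrite -intr_norm in h.
    have b0 : 0 <= b by apply: le_trans h; rewrite ler0z.
    by rewrite /N truncn_ge_nat// pmulrn abszE.
  exists [ffun k => inord (absz (z k ord0 + N%:Z))].
  apply/colP => k; rewrite !mxE ffunE inordK.
    by have := zN k; move: (z k ord0) => c; lia.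
  by have := zN k; move: (z k ord0) => c; lia.
have [phi0 gphi0] := g_onto z0 Pz0 (lexx _).
pose Q phi := `[< P (g phi) >].
have Q0 : Q phi0 by apply/asboolP; rewrite gphi0.
case: (arg_minP (fun phi => f (g phi)) Q0) => phi /asboolP Pphi phi_min.
exists (g phi) => // z' Pz'; have [z'0|/ltW z'0] := leP (f z') (f z0).
  have [psi e] := g_onto z' Pz' z'0.
  by rewrite -e; apply: phi_min; apply/asboolP; rewrite e.
by apply: le_trans z'0; rewrite -gphi0; exact: phi_min.
Qed.

(** * Lattice points in boxes and minimizers over the lattice *)

Section Lattice.
Variables (R : realType) (m n : nat) (Theta : 'M[R]_(n, m)).
Implicit Types (u v w : 'cV[R]_(m + n)).

Lemma invmx_T_mx : invmx (T_mx Theta) = block_mx 1%:M 0 (- Theta) 1%:M.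
Proof.
have TT : T_mx Theta *m block_mx 1%:M 0 (- Theta) 1%:M = 1%:M.
  rewrite mulmx_block !mulmx1 !mul1mx !mul0mx !mulmx0 !addr0 add0r subrr.
  by rewrite -scalar_mx_block.
have [T_unit _] := mulmx1_unit TT.
by rewrite -[RHS](mulKmx T_unit) TT mulmx1.
Qed.

Lemma LambdaP u : Lambda Theta u <-> exists (x : 'cV[int]_m) (y : 'cV[int]_n),
  u = col_mx (map_mx intr x) (map_mx intr y - Theta *m map_mx intr x).
Proof.
have E (x : 'cV[int]_m) (y : 'cV[int]_n) :
    invmx (T_mx Theta) *m map_mx intr (col_mx x y)
    = col_mx (map_mx intr x) (map_mx intr y - Theta *m map_mx intr x) :> 'cV[R]_(m + n).
  rewrite invmx_T_mx map_col_mx mul_block_col !mul1mx mul0mx addr0 mulNmx.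
  by rewrite addrC.
split=> [[_ [z _ <-] <-]|[x [y ->]]].
  by exists (usubmx z), (dsubmx z); rewrite -{1}(vsubmxK z) E.
by rewrite -E; exists (map_mx intr (col_mx x y)) => //; exists (col_mx x y).
Qed.

(** If the last n sides are all at most 1, this is [dirichlet_box]; otherwise a standard basis
    vector along a side longer than 1 lies in the lattice and in the box. Minkowski's convex body
    theorem has 1 in place of 2^(m+n), a loss that only shifts the logarithms of the minima by a
    bounded amount. *)
Lemma minkowski_box (r : 'I_(m + n) -> R) : (0 < m)%N ->
  (forall k, 0 < r k) -> 2 ^+ (m + n) < \prod_k r k ->
  exists u, [/\ Lambda Theta u, u != 0 & forall k, `|u k ord0| < r k].
Proof.
move=> m_gt0 r_gt0 vol.
have [B1|] := pselect (forall j, r (rshift m j) <= 1).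
  rewrite big_split_ord/= in vol.
  have [|x [y [x0 xA yB]]] := dirichlet_box Theta (fun i => r_gt0 (lshift n i)) _ vol.
    by move=> j; rewrite r_gt0 B1.
  exists (col_mx (map_mx intr x) (map_mx intr y - Theta *m map_mx intr x)); split.
  - by apply/LambdaP; exists x, y.
  - apply: contra x0 => /eqP; rewrite -col_mx0 => /eq_col_mx [/colP x0 _].
    by apply/eqP/colP => i; have := x0 i; rewrite !mxE => /eqP; rewrite intr_eq0 => /eqP.
  - move=> k; case: (split_ordP k) => i ->.
      by rewrite col_mxEu mxE.
    by rewrite col_mxEd mxE [X in _ + X]mxE mxE.
move=> /existsNP[j /negP]; rewrite -ltNge => rj.
exists (col_mx 0 (delta_mx j ord0)); split.
- apply/LambdaP; exists 0, (delta_mx j ord0).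
  by rewrite !map_mx0 mulmx0 subr0 map_delta_mx.
- apply/negP => /eqP; rewrite -col_mx0 => /eq_col_mx [_ /colP /(_ j)].
  by rewrite !mxE !eqxx => /eqP; rewrite oner_eq0.
- move=> k; case: (split_ordP k) => i ->; first by rewrite col_mxEu mxE normr0.
  rewrite col_mxEd mxE eqxx andbT; case: eqP => [->|_]; first by rewrite normr1.
  by rewrite normr0.
Qed.

Lemma lattice_argmin (P : set 'cV[R]_(m + n)) (f : 'cV[R]_(m + n) -> R) :
  P `<=` Lambda Theta -> P !=set0 ->
  (forall c, exists b, forall u, P u -> f u <= c -> forall k, `|u k ord0| <= b) ->
  exists2 v, P v & forall u, P u -> f v <= f u.
Proof.
move=> PL [u0 Pu0] bnd.
pose h (z : 'cV[int]_(m + n)) : 'cV[R]_(m + n) := invmx (T_mx Theta) *m map_mx intr z.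
have hP u : P u -> exists z, h z = u by move=> /PL [_ [z _ <-] <-]; exists z.
have [z0 hz0] := hP u0 Pu0; have [b b_bnd] := bnd (f u0).
have T_unit : T_mx Theta \in unitmx.
  have : invmx (T_mx Theta) \in unitmx; last by rewrite unitmx_inv.
  rewrite invmx_T_mx; apply: (proj1 (mulmx1_unit (B := T_mx Theta) _)).
  rewrite mulmx_block !mulmx1 !mul1mx !mul0mx !mulmx0 !addr0 add0r addNr.
  by rewrite -scalar_mx_block.
(* The integer vector behind u is T u, with coordinates bounded by [b] times a row sum of |T|;
   summing over all rows gives one bound for every coordinate. *)
have [||z Pz z_min] := @int_vec_argmin R _ (fun z => P (h z)) (fun z => f (h z))
   (\sum_k \sum_l `|T_mx Theta k l| * b) z0.
- by rewrite hz0.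
- move=> z Pz; rewrite hz0 => fz k.
  have -> : (z k ord0)%:~R = (T_mx Theta *m h z) k ord0.
    by rewrite mulKVmx// mxE.
  have hb := b_bnd _ Pz fz.
  have b0 : 0 <= b := le_trans (normr_ge0 _) (hb k).
  rewrite mxE; apply: le_trans (ler_norm_sum _ _ _) _.
  rewrite [X in _ <= X](bigD1 k)//= ler_wpDr//.
    by apply: sumr_ge0 => i _; apply: sumr_ge0 => l _; rewrite mulr_ge0.
  by apply: ler_sum => l _; rewrite normrM ler_wpM2l.
- exists (h z) => // u Pu; have [z' e] := hP u Pu.
  by rewrite -e; apply: z_min; rewrite e.
Qed.
End Lattice.

(** * The gauge of B(s), in terms of the sup norms of the two blocks *)

Section SupNorms.
Variables (R : realType) (m n : nat).
Implicit Types (u v w : 'cV[R]_(m + n)) (s l c : R).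

Definition hnorm u : R := \big[Num.max/0]_(i < m) `|u (lshift n i) ord0|.
Definition vnorm u : R := \big[Num.max/0]_(j < n) `|u (rshift m j) ord0|.

Lemma hnorm_ge0 u : 0 <= hnorm u. Proof. exact: bigmax_ge_id. Qed.
Lemma vnorm_ge0 u : 0 <= vnorm u. Proof. exact: bigmax_ge_id. Qed.

Lemma hnormZ c u : hnorm (c *: u) = `|c| * hnorm u.
Proof.
rewrite /hnorm (big_morph (fun x => `|c| * x) (id1 := 0) (op1 := Num.max)).
- by apply: eq_bigr => i _; rewrite mxE normrM.
- by move=> x y /=; rewrite maxr_pMr.
- by rewrite mulr0.
Qed.

Lemma vnormZ c u : vnorm (c *: u) = `|c| * vnorm u.
Proof.
rewrite /vnorm (big_morph (fun x => `|c| * x) (id1 := 0) (op1 := Num.max)).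
- by apply: eq_bigr => i _; rewrite mxE normrM.
- by move=> x y /=; rewrite maxr_pMr.
- by rewrite mulr0.
Qed.

Definition slope : R := m%:R / n%:R.

(** The gauge of B(s), by [dilateP]. As functions of s its two terms are exponentials of rates -1
    and m/n, the descending and ascending branches of u. *)
Definition boxnorm s u : R :=
  Num.max (hnorm u * expR (- s)) (vnorm u * expR (slope * s)).

Lemma tau_lshift s i : tau m n s ord0 (lshift n i) = s.
Proof. by rewrite /tau row_mxEl mxE. Qed.

Lemma tau_rshift s j : tau m n s ord0 (rshift m j) = - (slope * s).
Proof. by rewrite /tau row_mxEr mxE /slope mulrAC mulNr. Qed.

Lemma boxnorm_ge0 s u : 0 <= boxnorm s u.
Proof. by rewrite /boxnorm le_max mulr_ge0 ?hnorm_ge0 ?expR_ge0. Qed.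

Lemma boxnormP s u l : 0 <= l ->
  reflect (forall k, `|u k ord0| <= l * expR (tau m n s ord0 k)) (boxnorm s u <= l).
Proof.
move=> l0; rewrite /boxnorm ge_max.
rewrite -ler_pdivlMr ?expR_gt0// -[X in _ && X]ler_pdivlMr ?expR_gt0//.
rewrite -!expRN opprK; apply: (iffP andP).
  move=> [/bigmax_leP[_ h] /bigmax_leP[_ v]] k.
  by case: (split_ordP k) => i ->; rewrite ?tau_lshift ?tau_rshift ?h ?v.
move=> H; split; apply/bigmax_leP; split; rewrite ?mulr_ge0 ?expR_ge0// => i _.
  by have := H (lshift n i); rewrite tau_lshift.
by have := H (rshift m i); rewrite tau_rshift.
Qed.

Lemma boxnorm_ltP s u l : 0 < l ->
  reflect (forall k, `|u k ord0| < l * expR (tau m n s ord0 k)) (boxnorm s u < l).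
Proof.
move=> l0; rewrite /boxnorm gt_max.
rewrite -ltr_pdivlMr ?expR_gt0// -[X in _ && X]ltr_pdivlMr ?expR_gt0//.
rewrite -!expRN opprK; apply: (iffP andP).
  move=> [/bigmax_ltP[_ h] /bigmax_ltP[_ v]] k.
  by case: (split_ordP k) => i ->; rewrite ?tau_lshift ?tau_rshift ?h ?v.
move=> H; split; apply/bigmax_ltP; split; rewrite ?mulr_gt0 ?expR_gt0// => i _.
  by have := H (lshift n i); rewrite tau_lshift.
by have := H (rshift m i); rewrite tau_rshift.
Qed.

Lemma boxnormZ s c u : boxnorm s (c *: u) = `|c| * boxnorm s u.
Proof. by rewrite /boxnorm hnormZ vnormZ maxr_pMr// !mulrA. Qed.

Lemma boxnorm_gt0 s u : u != 0 -> 0 < boxnorm s u.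
Proof.
move=> u0; rewrite lt_neqAle boxnorm_ge0 andbT eq_sym.
apply: contra u0 => /eqP N0; have : boxnorm s u <= 0 by rewrite N0.
move=> /(boxnormP _ _ (lexx 0)) H; apply/eqP/colP => k; rewrite mxE.
by have := H k; rewrite mul0r normr_le0 => /eqP.
Qed.

(** The coordinate found here is the side of the box kept as narrow as the minimal vector in
    [logmin12_le]. *)
Lemma boxnorm_attained s u : u != 0 ->
  exists k, `|u k ord0| = boxnorm s u * expR (tau m n s ord0 k).
Proof.
move=> u0; have N0 := boxnorm_gt0 s u0; apply: contrapT => /forallNP H.
have : boxnorm s u < boxnorm s u; last by rewrite ltxx.
apply/boxnorm_ltP => // k; rewrite lt_neqAle; apply/andP; split.
  by apply/eqP; exact: H.
by apply/boxnormP => //; exact: boxnorm_ge0.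
Qed.

Lemma exp_diag_mxE d (t : 'rV[R]_d) (x : 'cV[R]_d) k :
  (exp_diag_mx t *m x) k ord0 = expR (t ord0 k) * x k ord0.
Proof. by rewrite /exp_diag_mx mul_diag_mx !mxE. Qed.

Lemma dilateP s u l : 0 < l ->
  dilate l (@parallelepiped R m n s) u <-> boxnorm s u <= l.
Proof.
move=> l0; split.
  move=> [_ [x x1 <-] <-]; apply/boxnormP => [|k]; first exact: ltW.
  rewrite mxE exp_diag_mxE !normrM (ger0_norm (ltW l0)).
  rewrite ler_wpM2l ?(ltW l0)// (ger0_norm (expR_ge0 _)).
  by rewrite ler_piMr ?expR_ge0//; exact: x1.
move=> /(boxnormP _ _ (ltW l0)) H.
exists (l^-1 *: u); last by rewrite scalerA mulfV ?scale1r// gt_eqF.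
exists (exp_diag_mx (- tau m n s) *m (l^-1 *: u)).
  move=> k; have tauN : (- tau m n s) ord0 k = - tau m n s ord0 k by rewrite mxE.
  rewrite exp_diag_mxE tauN [X in _ * X]mxE !normrM.
  rewrite (ger0_norm (expR_ge0 _)) ger0_norm ?invr_ge0 ?(ltW l0)//.
  by rewrite mulrCA expRN ler_pdivrMl// mulr1 ler_pdivrMl ?expR_gt0// mulrC.
apply/colP => k.
have tauN : (- tau m n s) ord0 k = - tau m n s ord0 k by rewrite mxE.
rewrite !exp_diag_mxE tauN mulrA -expRD subrr expR0.
by rewrite mul1r.
Qed.

End SupNorms.

(** * The first two successive minima of B(s) *)

Section Minima.
Variables (R : realType) (m n : nat) (Theta : 'M[R]_(n, m)).
Hypotheses (m_gt0 : (0 < m)%N) (n_gt0 : (0 < n)%N).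
Implicit Types (u v w : 'cV[R]_(m + n)) (s l c : R).

Local Notation mu := (slope R m n).

Definition nonzero_vec u := Lambda Theta u /\ u != 0.

Definition minimal_at s v :=
  nonzero_vec v /\ forall u, nonzero_vec u -> boxnorm s v <= boxnorm s u.

Lemma slope_gt0 : 0 < mu.
Proof. by rewrite divr_gt0 ?ltr0n. Qed.

(** The exponents sum to m s - n (m s / n) = 0, so B(s) has the same volume for all s. *)
Lemma prod_exp_tau s : \prod_k expR (tau m n s ord0 k) = 1.
Proof.
rewrite -expR_sum big_split_ord/=.
under eq_bigr do rewrite tau_lshift; under [X in _ + X]eq_bigr do rewrite tau_rshift.
rewrite !sumr_const !card_ord mulNrn -[mu * s *+ n]mulr_natr /slope.
rewrite mulrAC divfK ?pnatr_eq0 -?lt0n// mulr_natl subrr; exact: expR0.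
Qed.

(** Any constant above 2 would serve as well as 3; what matters is that it does not depend on s. *)
Lemma short_vec s : exists2 u, nonzero_vec u & boxnorm s u < 3.
Proof.
have [|k||u [Lu u0 ub]] := @minkowski_box R m n Theta (fun k => 3 * expR (tau m n s ord0 k)).
- by [].
- by rewrite mulr_gt0 ?expR_gt0.
- rewrite big_split/= prod_exp_tau mulr1 prodr_const card_ord.
  by rewrite ltrXn2r ?addn_gt0 ?m_gt0 ?ltr_nat// -lt0n addn_gt0 m_gt0.
- by exists u => //; apply/boxnorm_ltP.
Qed.

Lemma nonzero_vec_argmin (P : set 'cV[R]_(m + n)) (f : 'cV[R]_(m + n) -> R) :
  P `<=` nonzero_vec -> P !=set0 ->
  (forall c, exists b, forall u, P u -> f u <= c -> hnorm u <= b /\ vnorm u <= b) ->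
  exists2 v, P v & forall u, P u -> f v <= f u.
Proof.
move=> PL P0 bnd; apply: (@lattice_argmin R m n Theta) => //.
  by move=> u /PL[].
move=> c; have [b hb] := bnd c; exists b => u Pu fu k.
have [hu vu] := hb u Pu fu; case: (split_ordP k) => i ->.
  by apply: le_trans hu; exact: (le_bigmax _ (fun i => `|u (lshift n i) ord0|)).
by apply: le_trans vu; exact: (le_bigmax _ (fun j => `|u (rshift m j) ord0|)).
Qed.

Lemma minimal_at_exists s : exists v, minimal_at s v.
Proof.
have [w nw _] := short_vec s.
have [] := @nonzero_vec_argmin nonzero_vec (boxnorm s).
- by [].
- by exists w.
- move=> c; exists (Num.max (c * expR s) (c * expR (- (mu * s)))) => u _.
  rewrite /boxnorm ge_max -ler_pdivlMr ?expR_gt0// -[X in _ && X]ler_pdivlMr ?expR_gt0//.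
  by rewrite -!expRN opprK => /andP[h v]; rewrite !le_max h v orbT.
- by move=> v nv v_min; exists v.
Qed.

Local Notation minima s p := (succ_min (Lambda Theta) (@parallelepiped R m n s) p).

Lemma succ_min_ge s v p (V : p.+1.-tuple 'cV[R]_(m + n)) l : minimal_at s v ->
  0 < l -> free V ->
  (forall i, (Lambda Theta `&` dilate l (@parallelepiped R m n s)) (tnth V i)) ->
  boxnorm s v <= l.
Proof.
move=> [_ v_min] l0 fV /(_ ord0)[LV /(dilateP _ _ l0)]; apply: le_trans.
apply: v_min; split=> //; exact: free_not0 fV (mem_tnth _ _).
Qed.

Lemma succ_min1 s v : minimal_at s v -> minima s 1 = boxnorm s v.
Proof.
move=> vmin; have [[Lv v0] _] := vmin; have N0 := boxnorm_gt0 s v0.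
rewrite /succ_min; set E := (X in inf X).
have lb : lbound E (boxnorm s v).
  by move=> l [l0 [V [fV HV]]]; exact: succ_min_ge vmin l0 fV HV.
have vin : E (boxnorm s v).
  split=> //; exists [tuple v]; split.
    by rewrite /= seq1_free.
  by move=> i; rewrite (ord1 i) (tnth_nth 0) /=; split=> //; apply/dilateP.
apply/le_anti/andP; split; first by apply: ge_inf vin; exists (boxnorm s v).
by apply: lb_le_inf => //; exists (boxnorm s v).
Qed.

(** The free pair [w], [u] makes the set under the infimum nonempty. The lower bound makes the
    second minimum positive, as the monotonicity of [ln] in [logmin2_le] requires. *)
Lemma succ_min2 s v u w : minimal_at s v -> nonzero_vec u -> Lambda Theta w ->
  (forall c, w <> c *: u) ->
  boxnorm s v <= minima s 2 <= Num.max (boxnorm s u) (boxnorm s w).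
Proof.
move=> vmin [Lu u0] Lw wu.
rewrite /succ_min; set E := (X in inf X).
have lb : lbound E (boxnorm s v).
  by move=> l [l0 [V [fV HV]]]; exact: succ_min_ge vmin l0 fV HV.
have M0 : 0 < Num.max (boxnorm s u) (boxnorm s w) by rewrite lt_max boxnorm_gt0.
have uwin : E (Num.max (boxnorm s u) (boxnorm s w)).
  split=> //; exists [tuple w; u]; split.
    rewrite /= free_cons seq1_free u0 andbT span_seq1.
    by apply/negP => /vlineP[c]; exact: wu.
  case=> [[|[|//]] ?]; rewrite (tnth_nth 0) /=; split=> //; apply/dilateP => //.
    by rewrite le_max lexx orbT.
  by rewrite le_max lexx.
apply/andP; split; first by apply: lb_le_inf => //; eexists; exact: uwin.
by apply: ge_inf uwin; exists (boxnorm s v).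
Qed.

Definition logmin p s : R := ln (minima s p).

Lemma logmin1 s v : minimal_at s v -> logmin 1 s = ln (boxnorm s v).
Proof. by move=> vmin; rewrite /logmin (succ_min1 vmin). Qed.

Lemma minimal_at_gt0 s v : minimal_at s v -> 0 < boxnorm s v.
Proof. by move=> [[_ v0] _]; exact: boxnorm_gt0. Qed.

Lemma logmin1_le s : logmin 1 s <= ln 3.
Proof.
have [v vmin] := minimal_at_exists s; have [u nu u3] := short_vec s.
rewrite (logmin1 vmin) ler_ln ?posrE ?(minimal_at_gt0 vmin)//.
by apply: le_trans (ltW u3); apply vmin.2.
Qed.

(** A nonzero lattice point has a nonzero integer among its first m coordinates, or else x = 0 and
    it has one among the last n. So one block has norm at least 1, and for s >= 0 either term of the
    gauge is then at least e^(-s). *)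
Lemma logmin1_ge s : 0 <= s -> - s <= logmin 1 s.
Proof.
move=> s0; have [v vmin] := minimal_at_exists s; rewrite (logmin1 vmin).
rewrite -[X in X <= _]expRK ler_ln ?posrE ?expR_gt0 ?(minimal_at_gt0 vmin)//.
have [[/LambdaP[x [y vE]] v0] _] := vmin.
have int_ge1 (z : int) : z != 0 -> 1 <= `|z%:~R| :> R.
  by move=> z0; rewrite -intr_norm ler1z -gtz0_ge1 normr_gt0.
rewrite /boxnorm le_max; have [x0|/negP x0] := eqVneq x 0.
  have [k yk] : exists k, y k ord0 != 0.
    apply: contrapT => /forallNP y0; move/negP: v0; apply; rewrite vE x0.
    rewrite map_mx0 mulmx0 subr0 -col_mx0; apply/eqP; congr col_mx.
    by apply/colP => k; rewrite !mxE; have /negP/negPn/eqP -> := y0 k.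
  apply/orP; right.
  have v1 : 1 <= vnorm v.
    apply: le_trans (le_bigmax _ (fun j => `|v (rshift m j) ord0|) k).
    by rewrite vE x0 col_mxEd map_mx0 mulmx0 subr0 mxE int_ge1.
  rewrite -[X in X <= _]mul1r ler_pM ?expR_ge0// ler_expR.
  by have := mulr_ge0 (ltW slope_gt0) s0; lra.
have [k xk] : exists k, x k ord0 != 0.
  apply: contrapT => /forallNP y0; apply: x0.
  by apply/eqP/colP => k; rewrite !mxE; have /negP/negPn/eqP -> := y0 k.
apply/orP; left; rewrite -[X in X <= _]mul1r ler_wpM2r ?expR_ge0//.
apply: le_trans (le_bigmax _ (fun j => `|v (lshift n j) ord0|) k).
by rewrite vE col_mxEu mxE int_ge1.
Qed.

Lemma logmin2_le s v w : minimal_at s v -> nonzero_vec w ->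
  (forall c, w <> c *: v) ->
  logmin 2 s <= ln (Num.max (boxnorm s v) (boxnorm s w)).
Proof.
move=> vmin [Lw w0] wv; have := succ_min2 vmin vmin.1 Lw wv.
move=> /andP[h1 h2]; have N0 := minimal_at_gt0 vmin.
by rewrite /logmin ler_ln ?posrE ?(lt_le_trans N0 h1)// lt_max N0.
Qed.

(* Minkowski's first theorem for the box that is as wide as v in one direction
   where v attains its norm: the point found is too short to be a multiple of v. *)
Lemma logmin12_le s : (1 < m + n)%N ->
  logmin 1 s + ((m + n)%:R - 1) * logmin 2 s <= (m + n)%:R * ln 3.
Proof.
move=> d_gt1; have [v vmin] := minimal_at_exists s.
have N0 := minimal_at_gt0 vmin; have [k vk] := boxnorm_attained s vmin.1.2.
have D0 : 0 < (m + n)%:R - 1 :> R by rewrite subr_gt0 ltr1n.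
set D := (m + n)%:R - 1 in D0 *; set lv := ln (boxnorm s v).
(* Chosen so that [boxnorm s v] times rho^(m+n-1) equals 3^(m+n), above the threshold of
   [minkowski_box]. *)
pose rho := expR (((m + n)%:R * ln 3 - lv) / D).
pose r j := (if j == k then boxnorm s v else rho) * expR (tau m n s ord0 j).
have [|j||w [Lw w0 wr]] := @minkowski_box R m n Theta r.
- by [].
- by rewrite mulr_gt0 ?expR_gt0//; case: ifP; rewrite ?expR_gt0.
- rewrite /r big_split/= prod_exp_tau mulr1 (bigD1 k)//= eqxx.
  under eq_bigr => j jk do rewrite (negbTE jk).
  rewrite prodr_const cardC1 card_ord -expRM_natl.
  have -> : (m + n).-1%:R = D :> R by rewrite /D -subn1 natrB// ltnW.
  rewrite mulrCA mulfV ?gt_eqF// mulr1 expRD expRN /lv lnK ?posrE//.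
  rewrite mulrCA mulfV ?gt_eqF// mulr1 expRM_natl lnK ?posrE//.
  by rewrite ltrXn2r ?ltr_nat// -lt0n ltnW.
have wv c : w <> c *: v.
  move=> wE; have := wr k; rewrite /r eqxx wE mxE normrM vk.
  rewrite gtr_pMl ?mulr_gt0 ?expR_gt0// => c1.
  have := vmin.2 w (conj Lw w0); rewrite wE boxnormZ leNgt.
  by rewrite gtr_pMl// c1.
have h1 := logmin2_le vmin (conj Lw w0) wv.
have M : Num.max (boxnorm s v) (boxnorm s w) <= Num.max (boxnorm s v) rho.
  rewrite ge_max le_max lexx/=; apply/boxnormP => [|j].
    by rewrite le_max expR_ge0 orbT.
  apply: le_trans (ltW (wr j)) _; rewrite ler_wpM2r ?expR_ge0//.
  by case: ifP => _; rewrite le_max lexx ?orbT.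
have {h1} h2 : logmin 2 s <= ln (Num.max (boxnorm s v) rho).
  by apply: le_trans h1 _; rewrite ler_ln ?posrE// lt_max N0.
have l3 := logmin1_le s; rewrite (logmin1 vmin) -/lv in l3 *.
have dR : (m + n)%:R = D + 1 :> R by rewrite /D; ring.
(* If the maximum is [rho], its definition gives the claim; otherwise [logmin 2 s] is at most [lv],
   itself at most ln 3. *)
move: h2; rewrite /Num.max; case: ifP => _.
  rewrite expRK ler_pdivlMr// mulrC; lra.
rewrite -/lv -(ler_pM2l D0) => h2; rewrite dR.
have : D * lv <= D * ln 3 by rewrite ler_pM2l.
lra.
Qed.

(* w minimizes Y among the lattice points with X w < X v, so no lattice point is
   smaller than both; at the parameter t where the line of v meets that of w, the
   first minimum is therefore at least their common value l.  Taking (X, Y) to be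
   (hnorm, vnorm), resp. (vnorm, hnorm), gives a t to the left, resp. right, of s. *)
Lemma minimal_exchange (X Y : 'cV[R]_(m + n) -> R) (al be s : R) v :
  (forall t u, boxnorm t u = Num.max (X u * expR (- (al * t))) (Y u * expR (be * t))) ->
  (forall c u, X (c *: u) = `|c| * X u) ->
  (forall u, hnorm u <= Num.max (X u) (Y u) /\ vnorm u <= Num.max (X u) (Y u)) ->
  al != 0 -> al + be != 0 -> minimal_at s v ->
  Y v * expR (be * s) <= X v * expR (- (al * s)) ->
  exists dl l, [/\ 0 <= (al + be) * dl, logmin 1 s = l - al * dl,
    l <= logmin 1 (s - dl) & logmin 2 s <= l + be * dl].
Proof.
move=> NE XZ bnd al0 albe0 vmin vX.
have Nv : boxnorm s v = X v * expR (- (al * s)) by rewrite NE; exact/max_idPl.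
have N0 := minimal_at_gt0 vmin.
have Xv0 : 0 < X v by move: N0; rewrite Nv pmulr_lgt0 ?expR_gt0.
have [|||w [nw Xw] wmin] :=
    @nonzero_vec_argmin (fun u => nonzero_vec u /\ X u < X v) Y.
- by move=> u [].
(* At this parameter the X term of the gauge of u is 3 X u / X v, so a gauge below 3 forces X u < X
   v. *)
- have [u nu u3] := short_vec (ln (X v / 3) / al); exists u; split=> //.
  move: u3; rewrite NE gt_max => /andP[+ _].
  rewrite mulrCA mulfV// mulr1 -lnV ?posrE ?divr_gt0// lnK ?posrE ?invr_gt0 ?divr_gt0//.
  by rewrite invf_div mulrA ltr_pdivrMr// mulrC ltr_pM2l.
- move=> c; exists (Num.max (X v) c) => u [_ Xu] Yu.
  have le_b : Num.max (X u) (Y u) <= Num.max (X v) c.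
    by rewrite ge_max !le_max (ltW Xu) Yu orbT.
  by have [h1 h2] := bnd u; split; [exact: le_trans h1 le_b|exact: le_trans h2 le_b].
have Xws : X w * expR (- (al * s)) < boxnorm s v by rewrite Nv ltr_pM2r ?expR_gt0.
have vw : boxnorm s v <= Y w * expR (be * s).
  by have := vmin.2 w nw; rewrite (NE s w) le_max leNgt Xws.
have Yw0 : 0 < Y w.
  by have := lt_le_trans N0 vw; rewrite pmulr_lgt0 ?expR_gt0.
have wv c : w <> c *: v.
  move=> wE; move: Xw; rewrite wE XZ gtr_pMl// => c1.
  have := vmin.2 w nw; rewrite wE boxnormZ leNgt.
  by rewrite gtr_pMl// c1.
(* [t] solves ln (X v) - al t = ln (Y w) + be t, and [l] is the common value. *)
pose t := (ln (X v) - ln (Y w)) / (al + be); pose l := ln (X v) - al * t.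
have tE : (al + be) * t = ln (X v) - ln (Y w) by rewrite /t mulrC divfK.
have lnM_expR x y : 0 < x -> ln (x * expR y) = ln x + y.
  by move=> x0; rewrite lnM ?posrE ?expR_gt0// expRK.
have e1 : logmin 1 s = ln (X v) - al * s by rewrite (logmin1 vmin) Nv lnM_expR.
exists (s - t), l; split.
- have := vw; rewrite Nv -ler_ln ?posrE ?mulr_gt0 ?expR_gt0// !lnM_expR//.
  by move: tE; rewrite mulrBr => ->; rewrite mulrDl; lra.
- by rewrite e1 /l mulrBr; ring.
- have -> : s - (s - t) = t by ring.
  have [z zmin] := minimal_at_exists t.
  rewrite (logmin1 zmin) -[X in X <= _]expRK ler_ln ?posrE ?expR_gt0 ?(minimal_at_gt0 zmin)//.
  rewrite NE le_max.
  (* Either X z >= X v, or z competes with w and Y z >= Y w; each alone brings the gauge of z at [t]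
     up to e^l. *)
  have [Xz|Xz] := leP (X v) (X z).
    apply/orP; left; rewrite /l expRD lnK ?posrE// ler_wpM2r ?expR_ge0//.
  apply/orP; right; have -> : l = ln (Y w) + be * t by move: tE; rewrite /l mulrDl; lra.
  rewrite expRD lnK ?posrE// ler_wpM2r ?expR_ge0//.
  by apply: wmin; split=> //; exact: zmin.1.
- apply: le_trans (logmin2_le vmin nw wv) _.
  have -> : Num.max (boxnorm s v) (boxnorm s w) = Y w * expR (be * s).
    have -> : boxnorm s w = Y w * expR (be * s).
      by rewrite NE; apply/max_idPr; exact: le_trans (ltW Xws) vw.
    exact/max_idPr.
  by rewrite lnM_expR//; move: tE; rewrite /l mulrBr mulrDl; lra.
Qed.

(** The alternatives correspond to the branch on which a minimal vector realizes its gauge at s: the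
    exchange parameter is s - dl for the descending branch, s + dl for the ascending one. *)
Lemma logmin_steps s : exists dl l, 0 <= dl /\
  ([/\ logmin 1 s = l - dl, l <= logmin 1 (s - dl) & logmin 2 s <= l + mu * dl] \/
   [/\ logmin 1 s = l - mu * dl, l <= logmin 1 (s + dl) & logmin 2 s <= l + dl]).
Proof.
have mu0 := slope_gt0; have [v vmin] := minimal_at_exists s.
have [hv|/ltW hv] := leP (vnorm v * expR (mu * s)) (hnorm v * expR (- s)).
  have [|c u|u|||||dl [l [dl0 l1 l2 l3]]] :=
      @minimal_exchange (@hnorm R m n) (@vnorm R m n) 1 mu s v.
  - by move=> t u; rewrite mul1r.
  - exact: hnormZ.
  - by rewrite !le_max !lexx orbT.
  - exact: oner_neq0.
  - by rewrite gt_eqF// addr_gt0.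
  - exact: vmin.
  - by rewrite mul1r.
  exists dl, l; split; first by rewrite -(pmulr_rge0 _ (addr_gt0 ltr01 mu0)).
  by left; split=> //; rewrite -[dl in RHS]mul1r.
(* With the norms exchanged the rates are al = - mu and be = -1; their sum is negative, so the [dl]
   obtained is nonpositive and its opposite is the witness. *)
have [|c u|u|||||dl [l [dl0 l1 l2 l3]]] :=
    @minimal_exchange (@vnorm R m n) (@hnorm R m n) (- mu) (- 1) s v.
- by move=> t u; rewrite /boxnorm maxC !mulNr opprK mul1r.
- exact: vnormZ.
- by rewrite !le_max !lexx orbT.
- by rewrite oppr_eq0 gt_eqF.
- by rewrite -opprD oppr_eq0 gt_eqF// addr_gt0.
- exact: vmin.
- by rewrite !mulNr opprK mul1r.
exists (- dl), l; split.
  by rewrite -(pmulr_rge0 _ (addr_gt0 mu0 ltr01)) mulrN -mulNr opprD.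
right; split=> //.
- by rewrite l1; ring.
- by rewrite mulN1r in l3.
Qed.

End Minima.

(** * Real inequalities bounding the sum of the first two logarithmic minima *)

Lemma D_ge (R : realType) (M N a D : R) : 1 <= N -> 3 <= M + N -> 0 <= a ->
  ((D = N - 1 - N * a /\ 2 * a * N <= N - M) \/
    (D = M - 1 + N * a /\ N - M <= 2 * a * N)) ->
  M + N - 2 <= 2 * D.
(* The two candidates for D add up to M + N - 2, and the side condition says that D is the larger
   one. *)
Proof. by move=> N1 MN3 a0 [] [-> h]; nra. Qed.

(* In the first case the bound 2 l + (M / N - 1) dl for l1 + l2 suffices.  In the
   second, it is combined with (M + N - 2) / (M + N - 1) l1 + O(1), with weights
   chosen so that l appears with coefficient (M + N - 2) / D. *)
Lemma descending_bound (R : realType) (M N a D c l dl l1 l2 s : R) :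
  1 <= M -> 1 <= N -> 3 <= M + N -> 0 <= a -> a <= 1 -> 0 <= c ->
  ((D = N - 1 - N * a /\ 2 * a * N <= N - M) \/
    (D = M - 1 + N * a /\ N - M <= 2 * a * N)) ->
  0 <= dl -> 0 <= s - dl ->
  l1 = l - dl -> l2 <= l + M / N * dl -> l1 + (M + N - 1) * l2 <= (M + N) * c ->
  exists W : R, 0 <= W <= 2 * D /\
    D * (l1 + l2) <= W * (l + a * (s - dl)) - (M + N - 2) * a * s + 2 * D * c.
Proof.
move=> M1 N1 MN3 a0 a1 c0 DE.
move=> dl0 t0 l1E l2le sec; have D2 := D_ge N1 MN3 a0 DE.
have N_neq0 : N != 0 by rewrite gt_eqF// (lt_le_trans ltr01).
set t := s - dl in t0 *.
have sE : s = t + dl by rewrite /t; ring.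
have A : N * (l1 + l2) <= 2 * N * l + (M - N) * dl.
  have : N * l2 <= N * l + M * dl.
    apply: le_trans (ler_wpM2l (le_trans ler01 N1) l2le) _.
    by rewrite mulrDr [M / N]mulrC -mulrA mulVKf.
  by rewrite l1E; lra.
have B : (M + N - 1) * (l1 + l2) <= (M + N - 2) * l1 + (M + N) * c by lra.
case: DE => -[DD h].
- exists (2 * D); split; first by rewrite lexx andbT; lra.
  have A' : N * (l1 + l2) <= N * (2 * l - 2 * a * dl).
    have : 0 <= (N - M - 2 * a * N) * dl by rewrite mulr_ge0//; lra.
    lra.
  rewrite ler_pM2l in A'; last lra.
  have : D * (l1 + l2) <= D * (2 * l - 2 * a * dl) by rewrite ler_pM2l//; lra.
  have : 0 <= (2 * D - (M + N - 2)) * (a * t) by rewrite !mulr_ge0//; lra.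
  have : 0 <= (2 * D - (M + N - 2)) * (a * dl) by rewrite !mulr_ge0//; lra.
  have : 0 <= D * c by rewrite mulr_ge0//; lra.
  by rewrite sE; lra.
- exists (M + N - 2); split; first by apply/andP; split; lra.
  (* For these weights p of A and q of B, N p + (M + N - 1) q = (M + N) D. *)
  have p0 : 0 <= (M + N - 2) * (1 - a) by rewrite mulr_ge0//; lra.
  have q0 : 0 <= M - N + 2 * a * N by lra.
  have := ler_wpM2l p0 A; have := ler_wpM2l q0 B => hB hA.
  have : (M + N) * (D * (l1 + l2)) <= (M + N) * ((M + N - 2) * l - (M + N - 2) * a * dl
     + (M - N + 2 * a * N) * c).
    by rewrite l1E in hB hA *; rewrite DD; lra.
  rewrite ler_pM2l; last lra.
  have : (M - N + 2 * a * N) * c <= 2 * D * c by rewrite ler_wpM2r//; lra.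
  by rewrite sE; lra.
Qed.

(** The two cases trade places with those of the descending branch: here the second follows from the
    bound 2 l + (1 - M / N) dl alone, and the first needs the combination with Minkowski's bound. *)
Lemma ascending_bound (R : realType) (M N a D c l dl l1 l2 s : R) :
  1 <= M -> 1 <= N -> 3 <= M + N -> 0 <= a -> a <= 1 -> 0 <= c ->
  ((D = N - 1 - N * a /\ 2 * a * N <= N - M) \/
    (D = M - 1 + N * a /\ N - M <= 2 * a * N)) ->
  0 <= dl -> 0 <= s ->
  l1 = l - M / N * dl -> l2 <= l + dl -> l1 + (M + N - 1) * l2 <= (M + N) * c ->
  exists W : R, 0 <= W <= 2 * D /\
    D * (l1 + l2) <= W * (l + a * (s + dl)) - (M + N - 2) * a * s + 2 * D * c.
Proof.
move=> M1 N1 MN3 a0 a1 c0 DE.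
move=> dl0 s0 l1E l2le sec; have D2 := D_ge N1 MN3 a0 DE.
have N_neq0 : N != 0 by rewrite gt_eqF// (lt_le_trans ltr01).
have Nl1 : N * l1 = N * l - M * dl.
  by rewrite l1E mulrBr [M / N]mulrC -mulrA mulVKf.
have A : N * (l1 + l2) <= 2 * N * l + (N - M) * dl.
  have : N * l2 <= N * (l + dl) by rewrite ler_pM2l//; lra.
  by move=> h; rewrite mulrDr Nl1; lra.
have B : (M + N - 1) * (N * (l1 + l2)) <= (M + N - 2) * (N * l1) + (M + N) * c * N.
  have : N * (l1 + (M + N - 1) * l2) <= N * ((M + N) * c) by rewrite ler_pM2l//; lra.
  lra.
case: DE => -[DD h].
- exists (M + N - 2); split; first by apply/andP; split; lra.
  (* For these weights p of A and q of B, p + (M + N - 1) q = (M + N) D. *)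
  have p0 : 0 <= (M + N - 2) * (M + N * a).
    have Na0 : 0 <= N * a by rewrite mulr_ge0//; lra.
    by rewrite mulr_ge0//; lra.
  have q0 : 0 <= N - M - 2 * a * N by lra.
  have := ler_wpM2l p0 A; have := ler_wpM2l q0 B => hB hA.
  have : N * (M + N) * (D * (l1 + l2)) <= N * (M + N) * ((M + N - 2) * l +
     (M + N - 2) * a * dl + (N - M - 2 * a * N) * c).
    by rewrite Nl1 in hB; rewrite DD; lra.
  rewrite ler_pM2l; last by rewrite mulr_gt0//; lra.
  have : (N - M - 2 * a * N) * c <= 2 * D * c.
    by rewrite ler_wpM2r//; have := mulr_ge0 a0 (le_trans ler01 N1); lra.
  lra.
- exists (2 * D); split; first by rewrite lexx andbT; lra.
  have A' : N * (l1 + l2) <= N * (2 * l + 2 * a * dl).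
    have : 0 <= (2 * a * N - (N - M)) * dl by rewrite mulr_ge0//; lra.
    lra.
  rewrite ler_pM2l in A'; last lra.
  have : D * (l1 + l2) <= D * (2 * l + 2 * a * dl) by rewrite ler_pM2l//; lra.
  have : 0 <= (2 * D - (M + N - 2)) * (a * s) by rewrite !mulr_ge0//; lra.
  have : 0 <= D * c by rewrite mulr_ge0//; lra.
  lra.
Qed.

(** At the exchange parameter t, l + a t is at most a small multiple of t, and t is at most a fixed
    multiple of s; the two branch bounds then leave an error below e s. Here [a] stands for minus
    the first upper limit. *)
Lemma sum_bound (R : realType) (M N a D c : R) (l1 l2 : R -> R) :
  1 <= M -> 1 <= N -> 3 <= M + N -> 0 <= a -> a <= 1 -> 0 <= c ->
  ((D = N - 1 - N * a /\ 2 * a * N <= N - M) \/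
    (D = M - 1 + N * a /\ N - M <= 2 * a * N)) ->
  (forall s : R, l1 s <= c) -> (forall s : R, 0 <= s -> - s <= l1 s) ->
  (forall s : R, l1 s + (M + N - 1) * l2 s <= (M + N) * c) ->
  (forall s : R, exists dl l : R, 0 <= dl /\
    ([/\ l1 s = l - dl, l <= l1 (s - dl) & l2 s <= l + M / N * dl] \/
     [/\ l1 s = l - M / N * dl, l <= l1 (s + dl) & l2 s <= l + dl])) ->
  (forall e : R, 0 < e -> exists S : R, forall t : R, S <= t -> l1 t <= (e - a) * t) ->
  forall e : R, 0 < e -> exists S : R, forall s : R, S <= s ->
  l1 s + l2 s <= (e - (M + N - 2) * a / D) * s.
Proof.
move=> M1 N1 MN3 a0 a1 c0 DE l1_le l1_ge l12_le steps l1_lim e e0.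
have N_neq0 : N != 0 by rewrite gt_eqF// (lt_le_trans ltr01).
have M_neq0 : M != 0 by rewrite gt_eqF// (lt_le_trans ltr01).
have D2 := D_ge N1 MN3 a0 DE; have D0 : 0 < D by lra.
(* [k] bounds t / s: on the ascending branch -s <= l1 s and l <= c <= s give (M / N) dl <= 2 s. *)
pose k : R := 1 + 2 * N / M; have NM0 : 0 <= N / M by rewrite divr_ge0//; lra.
have kE : k = 1 + 2 * (N / M) by rewrite /k mulrA.
have k1 : 1 <= k by rewrite kE; lra.
(* Multiplied by t <= k s and W <= 2 D, this tolerance costs D e s / 2; the other half of D e s
   absorbs 2 D c. *)
have ke0 : 0 < e / (4 * k) by rewrite divr_gt0//; lra.
have [S0 hS0] := l1_lim _ ke0.
pose T := Num.max S0 0; have T0 : 0 <= T by rewrite le_max lexx orbT.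
have ST : S0 <= T by rewrite le_max lexx.
have [q qE] : exists q : R, q = 4 * (c + T) / e by exists (4 * (c + T) / e).
exists (T + c + q + 1) => s.
have q0 : 0 <= q by rewrite qE divr_ge0//; lra.
move=> sS; have s0 : 0 < s by lra.
have es : 4 * (c + T) <= e * s.
  by rewrite [e * s]mulrC -ler_pdivrMr// -qE; lra.
have cs : c <= s by lra.
have sT : T <= s by lra.
have conclude (W l t : R) : 0 <= W <= 2 * D -> 0 <= t -> t <= k * s ->
   l <= (e / (4 * k) - a) * t ->
   D * (l1 s + l2 s) <= W * (l + a * t) - (M + N - 2) * a * s + 2 * D * c ->
   l1 s + l2 s <= (e - (M + N - 2) * a / D) * s.
  move=> /andP[W0 WD] t0 ts lle h.
  rewrite -(ler_pM2l D0) mulrA mulrBr [D * (_ / D)]mulrCA mulfV ?gt_eqF// mulr1.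
  apply: le_trans h _.
  have h1 : l + a * t <= e / (4 * k) * t by lra.
  have h2 : e / (4 * k) * t <= e / 4 * s.
    apply: le_trans (ler_wpM2l (ltW ke0) ts) _.
    by rewrite le_eqVlt; apply/orP; left; apply/eqP; field; lra.
  have h3 : W * (l + a * t) <= 2 * D * (e / 4 * s).
    apply: le_trans (ler_wpM2l W0 (le_trans h1 h2)) _.
    by apply: ler_wpM2r => //; rewrite mulr_ge0//; lra.
  have h4 : D * (4 * (c + T)) <= D * (e * s) by rewrite ler_pM2l.
  have h5 : 0 <= D * T by rewrite mulr_ge0//; lra.
  lra.
have [dl [l [dl0 [[l1E lle l2le]|[l1E lle l2le]]]]] := steps s.
- have [tT|tT] := leP T (s - dl).
    have t0 : 0 <= s - dl by lra.
    have [W [W2 h]] := descending_bound M1 N1 MN3 a0 a1 c0 DE dl0 t0 l1E l2le (l12_le s).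
    apply: conclude W2 t0 _ _ h; first by nra.
    by apply: le_trans lle _; apply: hS0; lra.
  have lc : l <= c := le_trans lle (l1_le _).
  have aD : (M + N - 1) * a <= D by case: DE => -[-> ?]; nra.
  have h1 : (M + N - 2) * a / D * s <= (M + N - 2) / (M + N - 1) * s.
    rewrite ler_pM2r// ler_pdivrMr// mulrAC ler_pdivlMr; last lra.
    by rewrite -!mulrA ler_pM2l; lra.
  have : (M + N - 1) * (l1 s + l2 s) <= (M + N - 1) *
       (e * s - (M + N - 2) / (M + N - 1) * s).
    have -> : (M + N - 1) * (e * s - (M + N - 2) / (M + N - 1) * s)
       = (M + N - 1) * (e * s) - (M + N - 2) * s by field; lra.
    have h2 : (M + N - 2) * l1 s <= (M + N - 2) * (c + T - s) by rewrite ler_pM2l; lra.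
    have h3 : (M + N - 1) * (4 * (c + T)) <= (M + N - 1) * (e * s) by rewrite ler_pM2l//; lra.
    have := l12_le s; nra.
  rewrite ler_pM2l; last lra.
  lra.
- have [W [W2 h]] := ascending_bound M1 N1 MN3 a0 a1 c0 DE dl0 (ltW s0) l1E l2le (l12_le s).
  have t0 : 0 <= s + dl by lra.
  apply: conclude W2 t0 _ _ h.
    have lc : l <= c := le_trans lle (l1_le _).
    have h1 : M / N * dl <= 2 * s by have := l1_ge _ (ltW s0); lra.
    have h2 : dl <= 2 * (N / M) * s.
      have -> : dl = N / M * (M / N * dl) by field; apply/andP; split; lra.
      by apply: le_trans (ler_wpM2l NM0 h1) _; lra.
    by rewrite kE; lra.
  by apply: le_trans lle _; apply: hS0; lra.
Qed.

(** * Upper limits at infinity and the conclusion *)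

Section LimfEsup.
Variables (R : realType) (f : R -> R).
Local Notation lsup := (limf_esup (fun s => (f s)%:E) (+oo : set_system R)).

Lemma limf_esup_pinfty_le x :
  (forall e, 0 < e -> exists S, forall s, S <= s -> f s <= x + e) ->
  (lsup <= x%:E)%E.
Proof.
move=> H; apply/lee_addgt0Pr => e e0; have [S HS] := H e e0.
rewrite limf_esupE; apply: (@le_trans _ _
  (ereal_sup [set (f s)%:E | s in [set s | S <= s]])).
  apply: ereal_inf_lbound; exists [set s | S <= s] => //.
  by exists S; split; [exact: num_real|move=> s /ltW].
by apply: ge_ereal_sup => _ [s Ss <-]; rewrite -EFinD lee_fin HS.
Qed.

Lemma limf_esup_pinfty_eventually x e : (lsup <= x%:E)%E -> 0 < e ->
  exists S, forall s, S <= s -> f s <= x + e.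
Proof.
move=> H e0; have : (lsup < (x + e)%:E)%E.
  by apply: le_lt_trans H _; rewrite lte_fin ltrDl.
rewrite limf_esupE => /ereal_inf_lt[_ [V [S [_ SV]] <-] Vlt].
exists (S + 1) => s Ss; rewrite -lee_fin; apply: le_trans (ltW Vlt).
by apply: ereal_sup_ubound; exists s => //; apply: SV; apply: lt_le_trans Ss; rewrite ltrDl.
Qed.

Lemma limf_esup_pinfty_ge x S : (forall s, S <= s -> x <= f s) -> (x%:E <= lsup)%E.
Proof.
move=> H; rewrite limf_esupE; apply: le_ereal_inf_tmp => _ [V [S' [_ SV]] <-].
pose s := Num.max S S' + 1.
apply: (@le_trans _ _ (f s)%:E).
  by rewrite lee_fin H// /s ler_wpDr// le_max lexx.
apply: ereal_sup_ubound; exists s => //; apply: SV.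
by rewrite /s ltr_pwDr// le_max lexx orbT.
Qed.
End LimfEsup.

(** Once the first upper limit is known to be a real number -a in [-1, 0], the rest is real
    arithmetic; the alternatives for D treat both inequalities of the theorem at once. *)
Lemma Psi_sup12 (R : realType) (m n : nat) (Theta : 'M[R]_(n, m)) :
  (1 <= m)%N -> (1 <= n)%N -> (3 <= m + n)%N ->
  exists a : R, [/\ 0 <= a, a <= 1, Psi_sup Theta 1 = (- a)%:E &
    forall D : R,
      (D = n%:R - 1 - n%:R * a /\ 2 * a * n%:R <= n%:R - m%:R) \/
      (D = m%:R - 1 + n%:R * a /\ n%:R - m%:R <= 2 * a * n%:R) ->
      (Psi_sup Theta 2 <= (- ((m%:R + n%:R - 2) * a / D))%:E)%E].
Proof.
move=> m_gt0 n_gt0 d_ge3; set L := logmin Theta.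
have PsiL1 s : Psi Theta 1 s = L 1 s / s by rewrite /Psi big_nat1.
have PsiL2 s : Psi Theta 2 s = (L 1 s + L 2 s) / s.
  by rewrite /Psi big_nat_recr//= big_nat1 mulrDl.
have c0 : 0 <= ln 3 :> R by rewrite ln_ge0// ler1n.
have hi : (Psi_sup Theta 1 <= 0%:E)%E.
  apply: limf_esup_pinfty_le => e e0; exists (ln 3 / e + 1) => s.
  have q0 : 0 <= ln 3 / e by rewrite divr_ge0// ltW.
  move=> sS; have s0 : 0 < s by lra.
  rewrite add0r PsiL1 ler_pdivrMr//; apply: le_trans (logmin1_le _ _ _ _) _ => //.
  by rewrite mulrC -ler_pdivrMr//; lra.
have lo : ((- 1)%:E <= Psi_sup Theta 1)%E.
  apply: (@limf_esup_pinfty_ge _ _ _ 1) => s s1; have s0 : 0 < s by lra.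
  by rewrite PsiL1 ler_pdivlMr// mulN1r; apply: logmin1_ge => //; exact: ltW.
have [b bE] : exists b, Psi_sup Theta 1 = b%:E.
  by case: (Psi_sup Theta 1) hi lo => [b _ _|//|//]; exists b.
rewrite bE !lee_fin in hi lo; exists (- b); rewrite opprK; split=> //; [lra|lra|].
move=> D DE; apply: limf_esup_pinfty_le => e e0.
have mnR : (m + n)%:R = m%:R + n%:R :> R by rewrite natrD.
have lim e' : 0 < e' -> exists S : R, forall t : R, S <= t -> L 1 t <= (e' - - b) * t.
  move=> e'0; have Hb : (Psi_sup Theta 1 <= b%:E)%E by rewrite bE.
  have [S HS] := limf_esup_pinfty_eventually Hb e'0.
  exists (Num.max S 1) => t; rewrite ge_max => /andP[St t1].
  have t0 : 0 < t by lra.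
  by have := HS t St; rewrite PsiL1 ler_pdivrMr// opprK addrC.
have m1 : 1 <= m%:R :> R by rewrite ler1n.
have n1 : 1 <= n%:R :> R by rewrite ler1n.
have mn3 : 3 <= m%:R + n%:R :> R by rewrite -mnR ler_nat.
have b0 : 0 <= - b by lra.
have b1 : - b <= 1 by lra.
have l1_le := @logmin1_le R m n Theta m_gt0 n_gt0.
have l1_ge := @logmin1_ge R m n Theta m_gt0 n_gt0.
have l12_le (s : R) : L 1 s + (m%:R + n%:R - 1) * L 2 s <= (m%:R + n%:R) * ln 3.
  by rewrite -mnR; apply: logmin12_le => //; apply: leq_trans d_ge3.
have steps := @logmin_steps R m n Theta m_gt0 n_gt0.
have [S HS] := sum_bound m1 n1 mn3 b0 b1 c0 DE l1_le l1_ge l12_le steps lim e0.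
exists (Num.max S 1) => t; rewrite ge_max => /andP[St t1].
have t0 : 0 < t by lra.
by rewrite PsiL2 ler_pdivrMr// [X in _ <= X * _]addrC; exact: HS.
Qed.

Local Open Scope ring_scope.
Local Open Scope ereal_scope.

Theorem theorem5 (R : realType) (m n : nat) (Theta : 'M[R]_(n, m))
    (m_ge1 : (1 <= m)%N) (n_ge1 : (1 <= n)%N) (d_ge3 : (3 <= m + n)%N) :
  (((m%:R - n%:R) / (2 * n%:R))%R%:E <= Psi_sup Theta 1 ->
     Psi_sup Theta 2 <=
       (((m + n)%:R - 2)%R%:E * Psi_sup Theta 1) /
       ((n%:R - 1)%R%:E + n%:R%:E * Psi_sup Theta 1)) /\
  (Psi_sup Theta 1 <= ((m%:R - n%:R) / (2 * n%:R))%R%:E ->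
     Psi_sup Theta 2 <=
       (((m + n)%:R - 2)%R%:E * Psi_sup Theta 1) /
       ((m%:R - 1)%R%:E - n%:R%:E * Psi_sup Theta 1)).
Proof.
have [a [a0 a1 Psi1 Psi2]] := Psi_sup12 Theta m_ge1 n_ge1 d_ge3.
have m1 : (1 <= m%:R :> R)%R by rewrite ler1n.
have n1 : (1 <= n%:R :> R)%R by rewrite ler1n.
have mn3 : (3 <= m%:R + n%:R :> R)%R by rewrite -natrD ler_nat.
have n20 : (0 < 2 * n%:R :> R)%R by lra.
(* With the first upper limit equal to -a, the two hypotheses on it become the two alternatives for
   D. *)
rewrite Psi1; split; rewrite lee_fin => H; move: (H).
- rewrite ler_pdivrMr// => {}H.
  have DE : ((n%:R - 1 - n%:R * a = n%:R - 1 - n%:R * a :> R /\ 2 * a * n%:R <= n%:R - m%:R :> R) \/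
     (n%:R - 1 - n%:R * a = m%:R - 1 + n%:R * a :> R /\ n%:R - m%:R <= 2 * a * n%:R :> R))%R.
    by left; split=> //; lra.
  apply: le_trans (Psi2 _ DE) _; have D2 := D_ge n1 mn3 a0 DE.
  (* Extended inversion treats 0 separately; [D_ge] makes the denominator positive. *)
  rewrite -!EFinM -EFinD inver !mulrN; rewrite ifF; last by apply: gt_eqF; lra.
  by rewrite -EFinM lee_fin natrD mulNr.
- rewrite ler_pdivlMr// => {}H.
  have DE : ((m%:R - 1 + n%:R * a = n%:R - 1 - n%:R * a :> R /\ 2 * a * n%:R <= n%:R - m%:R :> R) \/
     (m%:R - 1 + n%:R * a = m%:R - 1 + n%:R * a :> R /\ n%:R - m%:R <= 2 * a * n%:R :> R))%R.
    by right; split=> //; lra.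
  apply: le_trans (Psi2 _ DE) _; have D2 := D_ge n1 mn3 a0 DE.
  rewrite -!EFinM -EFinB inver !mulrN opprK; rewrite ifF; last by apply: gt_eqF; lra.
  by rewrite -EFinM lee_fin natrD mulNr.
Qed.
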